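(* Let $G$ be a simple graph with vertex set $[d]$, $d\ge1$, let $R$ and $K_G$ be as in the context, and let $T_G(n)=n^d-\chi_G(n)$ be the tail of the chromatic polynomial of $G$. Then $$\frac1t\sum_{n\ge0}T_G(n)t^n=\frac{h(R/K_G,t)}{(1-t)^d},$$ where $h(R/K_G,t)$ denotes the numerator of the Hilbert series of $R/K_G$ written over the denominator $(1-t)^d$, i.e. $h(R/K_G,t)=(1-t)^dF(R/K_G,t)$ with $F(R/K_G,t)=\sum_{n\ge0}\dim_{\mathbb k}(R/K_G)_nt^n$. Thus, up to a shift by one, the $W$-transform of $T_G$ equals the polynomial whose coefficients are the coordinates of the $h$-vector of the coloring complex of $G$.
   Context: $G$ is a simple graph with vertex set $[d]$; $\chi_G(m)$ is the number of maps $\phi:[d]\to[m]$ with $\phi(x)\neq\phi(y)$ for adjacent $x,y$. The $W$-transform of a polynomial $P$ of degree $\delta$ is the polynomial $W$ with $\sum_{n\ge0}P(n)t^n=W(t)/(1-t)^{\delta+1}$. For $\pi=a_1\cdots a_d\in\mathcal S_d$ and $k\in[d]$, $\ell(k)$ is the largest $r\ge0$ such that there are indices $i_0<\cdots<i_r=k$ with $a_{i_{s-1}}$ adjacent to $a_{i_s}$ for all $s$. An integer $k\in\{0,\dots,d-1\}$ is a cut of $\pi$ if $k=0$, or $\ell(k)<\ell(k+1)$, or $\ell(k)=\ell(k+1)$ and $a_k<a_{k+1}$. If the cuts are $0=i_1<\cdots<i_q$, the $G$-sequence of $\pi$ is $S_1,\dots,S_q$ with $S_j=\{a_{i_j+1},\dots,a_{i_{j+1}}\}$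 for $j<q$ and $S_q=\{a_{i_q+1},\dots,a_d\}$; the short $G$-sequence is $S_1,\dots,S_{q-1}$. Let $\mathbb k$ be a field, $A=\mathbb k[x_S:S\subseteq[d]]$ graded with each $x_S$ of degree $1$, $I$ the ideal generated by all $x_Sx_T$ with $S,T$ incomparable, and $R=A/I$ (face ring of the order complex of the Boolean algebra of all subsets of $[d]$). A basic coloring monomial is $x_{S_1}\cdots x_{S_k}$ ($k\ge0$) with $\emptyset\subsetneq S_1\subsetneq\cdots\subsetneq S_k\subsetneq[d]$ such that some $\pi$ has short $G$-sequence $S_1,S_2\setminus S_1,\dots,S_k\setminus S_{k-1}$; the coloring ideal $K_G\subseteq R$ is generated by these (squarefree) monomials. The coloring complex of $G$ is the simplicial complex whose face ring is $R/K_G$: its vertices are subsets of $[d]$, and its faces are the chains of subsets of $[d]$ containing no chain $\{S_1,\dots,S_k\}$ coming from a basic coloring monomial. Its $h$-vector is the coefficient sequence of the numerator of the Hilbert series of its face ring written over $(1-t)^{\dim+1}$. *)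

(* Defs.v *)
From mathcomp Require Import all_boot all_order all_fingroup all_algebra.
From mathcomp Require Import boolp.
From mathcomp Require Import mpoly.

Set Implicit Arguments.
Unset Strict Implicit.
Unset Printing Implicit Defensive.

Import GRing.Theory.
Local Open Scope ring_scope.

(* The identity of formal power series
     \sum_(n >= 0) a n * t ^ n = h(t) / (1 - t) ^ D,
   multiplied by the invertible series (1 - t) ^ D and read off
   coefficientwise. *)
Definition has_gf (a : nat -> int) (h : {poly int}) (D : nat) : Prop :=
  forall n : nat,
    h`_n = \sum_(i < n.+1) ((1 - 'X : {poly int}) ^+ D)`_i * a (n - i)%N.

(* For P <> 0, [size P] is delta + 1 with delta the degree of P.  For P = 0
   this gives W = 0, as any other choice of the exponent would. *)
Definition W_transform (P W : {poly int}) : Prop :=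
  has_gf (fun n => P.[n%:R]) W (size P).

Section Ideals.
Variable A : comNzRingType.

Definition ideal_gen (M : A -> Prop) (p : A) : Prop :=
  exists2 s : seq (A * A),
    (forall q, q \in s -> M q.2) & p = \sum_(q <- s) q.1 * q.2.

(* [ideal_mod I M] is the inverse image in A of the ideal of A / I generated
   by the classes of the elements of M, so that A / [ideal_mod I M] is the
   quotient of A / I by that ideal. *)
Definition ideal_mod (I M : A -> Prop) (p : A) : Prop :=
  exists2 q, ideal_gen M q & I (p - q).

End Ideals.

Section Hilbert.
Variables (k : fieldType) (N : nat).
Implicit Type J : {mpoly k[N]} -> Prop.

Definition indep_mod J (m : nat) (b : 'I_m -> {mpoly k[N]}) : Prop :=
  forall c : 'I_m -> k, J (\sum_i c i *: b i) -> forall i, c i = 0.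

(* The classes modulo J of m forms of degree n are a basis of the
   degree n component of k[x_1, ..., x_N] / J. *)
Definition quot_dim J (n m : nat) : Prop :=
  exists b : 'I_m -> {mpoly k[N]},
    [/\ forall i, b i \is n.-homog,
        indep_mod J b
      & forall p : {mpoly k[N]}, p \is n.-homog ->
          exists c : 'I_m -> k, J (p - \sum_i c i *: b i)].

(* The default value 0 is irrelevant when J is an ideal: see [hilbertP] and
   [quot_dim_uniq]. *)
Definition hilbert J (n : nat) : nat :=
  if pselect (exists m, quot_dim J n m) is left ex then projT1 (cid ex) else 0%N.

End Hilbert.

Section FaceRing.
Variables (k : fieldType) (V : finType).

Definition xvar (v : V) : {mpoly k[#|V|]} := 'X_(enum_rank v).

(* Ideal of the face ring, on the variables x_v, v : V.  An element of V need
   not be a vertex: x_v belongs to the ideal when {v} is not a face. *)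
Definition face_ideal (face : {set V} -> Prop) : {mpoly k[#|V|]} -> Prop :=
  ideal_gen (fun p => exists2 C : {set V}, ~ face C & p = \prod_(v in C) xvar v).

(* dim + 1, and 0 for the complex without faces. *)
Definition dim1 (face : {set V} -> Prop) : nat :=
  \max_(C : {set V} | `[< face C >]) #|C|.

Definition h_vector (face : {set V} -> Prop) (h : {poly int}) : Prop :=
  has_gf (fun n => (hilbert (face_ideal face) n)%:Z) h (dim1 face).

End FaceRing.

Section Coloring.
Variables (d : nat) (adj : rel 'I_d).
Implicit Types (pi : 'S_d) (ss : seq {set 'I_d}).

Definition chi (n : nat) : nat :=
  #|[set f : {ffun 'I_d -> 'I_n} | [forall x, forall y, adj x y ==> (f x != f y)]]|.

Definition chromatic_tail (n : nat) : int := (n ^ d)%:Z - (chi n)%:Z.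

(* [d] is 'I_d = {0, ..., d-1}, and positions are counted from 0: the word
   a_1 ... a_d of pi is (pi 0) ... (pi (d-1)).  Below, [ell pi k] is therefore
   l(k+1) in 1-based notation.  A strictly increasing sequence of positions
   has at most d members, whence r < d. *)
Definition ell pi (k : 'I_d) : nat :=
  \max_(r < d | [exists i0 : 'I_d, exists s : r.-tuple 'I_d,
      path (fun i j : 'I_d => (i < j)%N && adj (pi i) (pi j)) i0 s
      && (last i0 s == k)]) r.

(* The cut after the first k letters: it compares the letters at the 0-based
   positions j = k - 1 and k. *)
Definition cut pi (k : 'I_d) : bool :=
  (k == 0 :> nat) ||
  [exists j : 'I_d, (j.+1 == k :> nat) &&
     ((ell pi j < ell pi k)%N ||
      (ell pi j == ell pi k) && (pi j < pi k)%N)].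

Definition cuts pi : seq nat := [seq nat_of_ord k | k <- enum 'I_d & cut pi k].

Definition block pi (lo hi : nat) : {set 'I_d} :=
  [set pi p | p : 'I_d & (lo <= p < hi)%N].

(* The default value d of [nth] supplies the right end of the last block. *)
Definition G_sequence pi : seq {set 'I_d} :=
  [seq block pi (nth d (cuts pi) j) (nth d (cuts pi) j.+1)
     | j <- iota 0 (size (cuts pi))].

Definition short_G_sequence pi : seq {set 'I_d} :=
  take (size (G_sequence pi)).-1 (G_sequence pi).

Definition basic_chain ss : bool :=
  path (fun S T : {set 'I_d} => S \proper T) set0 (rcons ss setT) &&
  [exists pi : 'S_d,
     short_G_sequence pi == pairmap (fun S T : {set 'I_d} => T :\: S) set0 ss].

Section Ideal.
Variable k : fieldType.
Let A := {mpoly k[#|{set 'I_d}|]}.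

(* R is A modulo this ideal. *)
Definition boolean_ideal : A -> Prop :=
  ideal_gen (fun p => exists S T : {set 'I_d},
    [/\ ~~ (S \subset T), ~~ (T \subset S) & p = xvar k S * xvar k T]).

Definition basic_coloring_monomial (p : A) : Prop :=
  exists2 ss, basic_chain ss & p = \prod_(S <- ss) xvar k S.

(* The inverse image in A of the ideal K_G of R: R / K_G is A modulo it. *)
Definition coloring_ideal : A -> Prop :=
  ideal_mod boolean_ideal basic_coloring_monomial.

End Ideal.

Definition coloring_complex (C : {set {set 'I_d}}) : Prop :=
  (forall S T, S \in C -> T \in C -> (S \subset T) || (T \subset S)) /\
  (forall ss, basic_chain ss -> ~ {subset ss <= C}).

End Coloring.

Arguments coloring_ideal [d] adj k p.

Section IdealFacts.
Variable A : comNzRingType.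

Lemma ideal_gen0 (M : A -> Prop) : ideal_gen M 0.
Proof. by exists [::] => //; rewrite big_nil. Qed.

Lemma ideal_genD (M : A -> Prop) p q :
  ideal_gen M p -> ideal_gen M q -> ideal_gen M (p + q).
Proof.
move=> [s hs ->] [t ht ->]; exists (s ++ t); last by rewrite big_cat.
by move=> u; rewrite mem_cat => /orP[/hs|/ht].
Qed.

Lemma ideal_genM (M : A -> Prop) a p : ideal_gen M p -> ideal_gen M (a * p).
Proof.
move=> [s hs ->]; exists [seq (a * q.1, q.2) | q <- s].
  by move=> u /mapP[v /hs vM ->].
by rewrite big_map mulr_sumr; apply: eq_bigr => q _; rewrite mulrA.
Qed.

Definition is_ideal (J : A -> Prop) : Prop :=
  [/\ J 0, forall p q, J p -> J q -> J (p + q) & forall a p, J p -> J (a * p)].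

Lemma ideal_genP (M : A -> Prop) : is_ideal (ideal_gen M).
Proof. by split; [exact: ideal_gen0|exact: ideal_genD|exact: ideal_genM]. Qed.

Lemma ideal_modP (I M : A -> Prop) : is_ideal I -> is_ideal (ideal_mod I M).
Proof.
move=> [I0 ID IM]; split.
- by exists 0; [exact: ideal_gen0|rewrite subr0].
- move=> p q [p' Mp Ip] [q' Mq Iq]; exists (p' + q'); first exact: ideal_genD.
  by rewrite opprD addrACA; apply: ID.
- move=> a p [p' Mp Ip]; exists (a * p'); first exact: ideal_genM.
  by rewrite -mulrBr; apply: IM.
Qed.

End IdealFacts.

Section HilbertFacts.
Variables (k : fieldType) (N : nat) (J : {mpoly k[N]} -> Prop).
Hypothesis Jideal : is_ideal J.

Let J0 : J 0. Proof. by case: Jideal. Qed.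
Let JD p q : J p -> J q -> J (p + q). Proof. by case: Jideal => _ + _; exact. Qed.
Let JZ (c : k) p : J p -> J (c *: p).
Proof. by case: Jideal => _ _ JM Jp; rewrite -mul_mpolyC; exact: JM. Qed.

Lemma indep_mod_bound n m (b : 'I_m -> {mpoly k[N]}) :
  (forall i, b i \is n.-homog) -> indep_mod J b ->
  (m <= #|{: 'X_{1..N < n.+1}}|)%N.
Proof.
move=> hb ib; rewrite leqNgt; apply/negP => lt_m.
pose B := \matrix_(i < m, j < #|{: 'X_{1..N < n.+1}}|)
            (b i)@_(enum_val j : 'X_{1..N < n.+1}).
have rB : (\rank B < m)%N by exact: leq_ltn_trans (rank_leq_col B) lt_m.
have /rowV0Pn[v /sub_kermxP vB v0] : kermx B != 0.
  by rewrite -mxrank_eq0 mxrank_ker subn_eq0 -ltnNge.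
case/negP: v0; apply/eqP/rowP => i; rewrite mxE.
apply: (ib (fun i => v 0 i)).
suff -> : \sum_i v 0 i *: b i = 0 by [].
apply/mpolyP => mm; rewrite mcoeff0.
case: (eqVneq (mdeg mm) n) => [emm|nmm]; last first.
  apply: (@dhomog_nemf_coeff _ _ mdeg n) => //.
  by apply: rpred_sum => j _; apply: rpredZ.
have hmm : (mdeg mm < n.+1)%N by rewrite emm.
move/rowP/(_ (enum_rank (BMultinom hmm))): vB; rewrite !mxE => vB.
rewrite raddf_sum -[RHS]vB; apply: eq_bigr => j _.
by rewrite /= mcoeffZ mxE enum_rankK.
Qed.

Lemma quot_dim_exists n : exists m, quot_dim J n m.
Proof.
pose P m := `[< exists2 b : 'I_m -> {mpoly k[N]},
                  forall i, b i \is n.-homog & indep_mod J b >].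
have exP : exists m, P m.
  by exists 0%N; apply/asboolP; exists (fun=> 0) => [[]|c _ []].
have boundP m : P m -> (m <= #|{: 'X_{1..N < n.+1}}|)%N.
  by move/asboolP => [b hb ib]; apply: indep_mod_bound hb ib.
case: (ex_maxnP exP boundP) => m /asboolP[b hb ib] maxm; exists m, b; split=> //.
move=> p hp; apply: contrapT => np.
suff /maxm : P m.+1 by rewrite ltnn.
apply/asboolP; exists (fun i => if unlift ord_max i is Some j then b j else p).
  by move=> i; case: unliftP.
move=> c Jc.
have {}Jc : J (\sum_i c (lift ord_max i) *: b i + c ord_max *: p).
  move: Jc; rewrite big_ord_recr /= unlift_none.
  congr (J (_ + _)); apply: eq_bigr => i _.
  have -> : widen_ord (leqnSn m) i = lift ord_max i.
    by apply: val_inj; rewrite /= /bump leqNgt ltn_ord.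
  by rewrite liftK.
case: (eqVneq (c ord_max) 0) => [c0|c0].
  have ci : forall i, c (lift ord_max i) = 0.
    by apply: ib; move: Jc; rewrite c0 scale0r addr0.
  by move=> i; case: (unliftP ord_max i) => [j|] ->.
case: np; exists (fun i => - (c ord_max)^-1 * c (lift ord_max i)).
move: (JZ (c ord_max)^-1 Jc); rewrite scalerDr scalerA mulVf // scale1r addrC.
rewrite scaler_sumr -sumrN; congr (J (_ + _)); apply: eq_bigr => i _.
by rewrite scalerA mulNr scaleNr opprK.
Qed.

Lemma hilbertP n : quot_dim J n (hilbert J n).
Proof.
rewrite /hilbert; case: pselect => [ex|nex]; first exact: (projT2 (cid ex)).
by case: nex; exact: quot_dim_exists.
Qed.

Lemma quot_dim_le n m m' : quot_dim J n m -> quot_dim J n m' -> (m <= m')%N.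
Proof.
move=> [b [hb ib _]] [b' [_ _ sb']]; rewrite leqNgt; apply/negP => lt_m.
have /choice[C HC] : forall i, exists c : 'I_m' -> k,
    J (b i - \sum_j c j *: b' j) by move=> i; exact/sb'/hb.
pose B := \matrix_(i < m, j < m') C i j.
have rB : (\rank B < m)%N by exact: leq_ltn_trans (rank_leq_col B) lt_m.
have /rowV0Pn[v /sub_kermxP vB v0] : kermx B != 0.
  by rewrite -mxrank_eq0 mxrank_ker subn_eq0 -ltnNge.
case/negP: v0; apply/eqP/rowP => i; rewrite mxE.
apply: (ib (fun i => v 0 i)).
have -> : \sum_i v 0 i *: b i = \sum_i v 0 i *: (b i - \sum_j C i j *: b' j).
  under [RHS]eq_bigr do rewrite scalerBr scaler_sumr.
  rewrite sumrB exchange_big /= [X in _ - X]big1 ?subr0 // => j _.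
  under eq_bigr do rewrite scalerA.
  rewrite -scaler_suml; move/rowP/(_ j): vB; rewrite !mxE => vB.
  rewrite (_ : \sum_i _ = 0) ?scale0r // -[RHS]vB.
  by apply: eq_bigr => l _; rewrite mxE.
by apply: big_ind => // l _; exact: JZ.
Qed.

Lemma quot_dim_uniq n m m' : quot_dim J n m -> quot_dim J n m' -> m = m'.
Proof. by move=> h h'; apply/eqP; rewrite eqn_leq !(@quot_dim_le n). Qed.

End HilbertFacts.

(* Main.v *)
Require Import Defs.
From mathcomp Require Import mpoly.
From mathcomp Require Import all_boot all_order all_fingroup all_algebra.
From mathcomp Require Import boolp zify.

(** A coloring f : [d] -> {0, ..., n} is encoded by the chain of its level sets
    L_i = {v | f v <= i}, 0 <= i < n, that is by the monomial of degree n
    product of the x_(L_i); these are the standard monomials of R of degree n.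
    The monomial lies in K_G iff f is proper.  Indeed the blocks of a G-sequence
    are stable sets, so that a coloring refining them is proper; conversely,
    sorting the vertices by color and, inside a color, by decreasing length of
    the longest color-increasing path and decreasing label, gives a permutation
    with cuts only between color classes.  Hence dim (R/K_G)_n = T_G(n + 1).

    Grouping the improper colorings by their kernel writes T_G as a sum of
    falling factorials of degree < d, so its generating function is a polynomial
    over (1 - t)^d, without constant term since T_G(0) = 0. *)

Set Implicit Arguments.
Unset Strict Implicit.
Unset Printing Implicit Defensive.

Import GRing.Theory.
Local Open Scope ring_scope.

(** * Ideals spanned by monomials, with membership decided by supports *)

Section StandardMonomials.
Variables (k : fieldType) (V : finType).
Implicit Types (m : 'X_{1..#|V|}) (p : {mpoly k[#|V|]}).
Implicit Types (B : {set V} -> Prop) (C : {set V}).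

Definition mnm_supp m : {set V} := [set v | m (enum_rank v) != 0%N].

(** The face ideal and the inverse image of K_G are generated by squarefree monomials, so both are
    spanned by the monomials whose support lies in an up-closed family [B]; in this form their
    Hilbert functions are computed together. *)
Definition monomial_ideal B p : Prop :=
  forall m, m \in msupp p -> B (mnm_supp m).

Definition up_closed B : Prop := forall C C', C \subset C' -> B C -> B C'.

Lemma monomial_ideal_ideal B : up_closed B -> is_ideal (monomial_ideal B).
Proof.
move=> upB; split=> [m|p q Bp Bq m|a p Bp m].
- by rewrite msupp0.
- by move/msuppD_le; rewrite mem_cat => /orP[/Bp|/Bq].
- move/msuppM_le/allpairsP => [[m1 m2] /= [_ /Bp Bm ->]].
  apply: upB Bm; apply/subsetP => v; rewrite !inE mnmDE.
  by rewrite addn_eq0 negb_and orbC => ->.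
Qed.

Lemma monomial_idealX B m : B (mnm_supp m) -> monomial_ideal B 'X_[m].
Proof. by move=> Bm m'; rewrite msuppX inE => /eqP ->. Qed.

Lemma monomial_ideal_sub B (J : {mpoly k[#|V|]} -> Prop) p :
  is_ideal J -> (forall m, B (mnm_supp m) -> J 'X_[m]) ->
  monomial_ideal B p -> J p.
Proof.
move=> [J0 JD JM] JX Bp; rewrite [p]mpolyE big_seq.
apply: big_ind => // m /Bp /JX Jm.
by rewrite -mul_mpolyC; exact: JM.
Qed.

Lemma ideal_gen_sub (M J : {mpoly k[#|V|]} -> Prop) p :
  is_ideal J -> (forall q, M q -> J q) -> ideal_gen M p -> J p.
Proof.
move=> [J0 JD JM] MJ [s sM ->]; rewrite big_seq.
by apply: big_ind => // q /sM /MJ; exact: JM.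
Qed.

Lemma prod_xvar (s : seq V) :
  \prod_(v <- s) xvar k v = 'X_[\sum_(v <- s) U_(enum_rank v)]%MM.
Proof. by elim/big_rec2: _ => [|v m q _ ->]; rewrite ?mpolyX0 // mpolyXD. Qed.

Lemma mnm_sumU (s : seq V) v :
  (\sum_(u <- s) U_(enum_rank u))%MM (enum_rank v) = count_mem v s.
Proof.
rewrite mnm_sumE; elim: s => [|u s IHs]; first by rewrite big_nil.
by rewrite big_cons IHs mnm1E /= (inj_eq enum_rank_inj).
Qed.

Lemma mnm_supp_sumU (s : seq V) :
  mnm_supp (\sum_(v <- s) U_(enum_rank v))%MM = [set v in s].
Proof. by apply/setP => v; rewrite !inE mnm_sumU -lt0n -has_count has_pred1. Qed.

Lemma monomial_dvd (s : seq V) m : uniq s -> {subset s <= mnm_supp m} ->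
  exists a : {mpoly k[#|V|]}, 'X_[m] = a * \prod_(v <- s) xvar k v.
Proof.
move=> us ss; exists 'X_[m - \sum_(v <- s) U_(enum_rank v)].
rewrite prod_xvar -mpolyXD submK //; apply/mnm_lepP => i.
rewrite -[i]enum_valK mnm_sumU count_uniq_mem //.
by case: (boolP (_ \in _)) => [/ss|//]; rewrite inE enum_valK lt0n.
Qed.

Lemma face_ideal_monomial (face : {set V} -> Prop) p :
  up_closed (fun C => ~ face C) ->
  face_ideal face p <-> monomial_ideal (fun C => ~ face C) p.
Proof.
move=> upF; split.
  apply: ideal_gen_sub (monomial_ideal_ideal upF) _.
  move=> q [C nC ->]; rewrite -big_enum prod_xvar.
  apply: monomial_idealX; rewrite mnm_supp_sumU.
  by rewrite (_ : [set v in _] = C) //; apply/setP => v; rewrite inE mem_enum.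
apply: monomial_ideal_sub; first exact: ideal_genP.
move=> m nm; have [|v|a ->] := @monomial_dvd (enum (mnm_supp m)) m.
- exact: enum_uniq.
- by rewrite mem_enum.
- apply: ideal_genM; exists [:: (1, \prod_(v <- enum (mnm_supp m)) xvar k v)].
    move=> q; rewrite inE => /eqP -> /=; exists (mnm_supp m) => //.
    by rewrite -big_enum.
  by rewrite big_seq1 mul1r.
Qed.

End StandardMonomials.

(** * Hilbert functions by counting standard monomials *)

Section MonomialBasis.
Variables (k : fieldType) (N : nat).
Implicit Type J : {mpoly k[N]} -> Prop.

(** Membership in [J] is tested one coefficient at a time. Hence no nonzero combination of the
    standard monomials [M i] lies in [J], and removing the standard part of a form leaves an element
    of [J]. *)
Lemma quot_dim_monomial J (B : 'X_{1..N} -> Prop) n (I : finType)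
    (M : I -> 'X_{1..N}) :
  (forall p, J p <-> forall m, m \in msupp p -> B m) ->
  injective M -> (forall i, mdeg (M i) = n) -> (forall i, ~ B (M i)) ->
  (forall m, mdeg m = n -> ~ B m -> exists i, m = M i) ->
  quot_dim J n #|I|.
Proof.
move=> JP injM degM nBM surjM; exists (fun i => 'X_[M (enum_val i)]); split.
- by move=> i; rewrite dhomogX /= degM.
- move=> c /JP Bc i; apply/eqP/negP => /negP ci.
  apply: (nBM (enum_val i)); apply: Bc; rewrite mcoeff_msupp raddf_sum /=.
  rewrite (bigD1 i) //= mcoeffZ mcoeffX eqxx mulr1 big1 ?addr0 // => j ji.
  by rewrite mcoeffZ mcoeffX (inj_eq injM) (inj_eq enum_val_inj) (negPf ji) mulr0.
- move=> p hp; exists (fun i => p@_(M (enum_val i))); apply/JP => m.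
  rewrite mcoeff_msupp mcoeffB raddf_sum /= => Hm.
  apply: contrapT => nBm.
  have /eqP dm : mdeg m == n.
    apply: contraNT Hm => dm; rewrite (dhomog_nemf_coeff hp) // sub0r oppr_eq0.
    apply/eqP/big1 => i _; rewrite mcoeffZ mcoeffX.
    by case: eqP => [mi|]; rewrite ?mulr0 //; rewrite -mi degM eqxx in dm.
  have [i mi] := surjM m dm nBm.
  move: Hm; rewrite (bigD1 (enum_rank i)) //= enum_rankK -mi mcoeffZ mcoeffX.
  rewrite eqxx mulr1 opprD addrA subrr add0r oppr_eq0 big1 ?eqxx // => j ji.
  rewrite mcoeffZ mcoeffX mi (inj_eq injM); case: eqP => [e|]; rewrite ?mulr0 //.
  by rewrite -e enum_valK eqxx in ji.
Qed.

End MonomialBasis.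

(** * Colorings as monomials supported on chains *)

Section LevelMonomials.
Variable d : nat.
Implicit Types (v : 'I_d) (m : 'X_{1..#|{set 'I_d}|}).

Definition level n (f : {ffun 'I_d -> 'I_n.+1}) (i : nat) : {set 'I_d} :=
  [set v | f v <= i]%N.

Definition levels n (f : {ffun 'I_d -> 'I_n.+1}) : seq {set 'I_d} :=
  [seq level f i | i <- iota 0 n].

(* This encodes the colorings with n + 1 colors as the monomials of degree n
   supported on a chain; f is recovered as the number, with multiplicity, of sets
   that miss a given vertex. *)
Definition level_mnm n (f : {ffun 'I_d -> 'I_n.+1}) : 'X_{1..#|{set 'I_d}|} :=
  (\sum_(S <- levels f) U_(enum_rank S))%MM.

Lemma mdeg_level_mnm n (f : {ffun 'I_d -> 'I_n.+1}) : mdeg (level_mnm f) = n.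
Proof.
rewrite mdeg_sum (eq_bigr (fun=> 1%N)) => [|S _]; last by rewrite mdeg1.
by rewrite sum1_size size_map size_iota.
Qed.

Lemma mnm_supp_level_mnm n (f : {ffun 'I_d -> 'I_n.+1}) :
  mnm_supp (level_mnm f) = [set S in levels f].
Proof. exact: mnm_supp_sumU. Qed.

Lemma level_chain n (f : {ffun 'I_d -> 'I_n.+1}) i j :
  (i <= j)%N -> level f i \subset level f j.
Proof.
by move=> ij; apply/subsetP => v; rewrite !inE => /leq_trans; apply.
Qed.

Lemma count_levels n (f : {ffun 'I_d -> 'I_n.+1}) v :
  count (fun S : {set 'I_d} => v \notin S) (levels f) = f v.
Proof.
rewrite count_map (eq_count (a2 := fun i => (i < f v)%N)); last first.
  by move=> i; rewrite /= inE -ltnNge.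
have le_fn : (f v <= n)%N by rewrite -ltnS.
rewrite -[X in iota 0 X](subnKC le_fn) iotaD count_cat add0n.
rewrite (eq_in_count (a2 := predT)) ?count_predT ?size_iota; last first.
  by move=> i; rewrite mem_iota.
rewrite (eq_in_count (a2 := pred0)) ?count_pred0 ?addn0 // => i.
by rewrite mem_iota => /andP[/leq_gtF].
Qed.

Lemma level_mnm_inj n : injective (@level_mnm n).
Proof.
move=> f g fg; apply/ffunP => v; apply: val_inj => /=.
rewrite -[LHS]count_levels -[RHS]count_levels.
have /seq.permP-> // : perm_eq (levels f) (levels g).
by apply/allP => S _ /=; rewrite -!mnm_sumU -/(level_mnm f) fg.
Qed.

Lemma mnm_sum_seq m :
  exists s : seq {set 'I_d}, m = (\sum_(S <- s) U_(enum_rank S))%MM.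
Proof.
elim: (mdeg m) {-2}m (erefl (mdeg m)) => [|n IHn] {}m dm.
  exists [::]; rewrite big_nil; apply/eqP; by rewrite -mdeg_eq0 dm.
have [i mi] : exists i, (0 < m i)%N.
  apply/existsP; apply: contra_eqT dm => /existsPn m0.
  rewrite (_ : m = 0%MM) ?mdeg0 //; apply/mnmP => i.
  by apply/eqP; rewrite mnm0E -leqn0 leqNgt m0.
have Ui : (U_(i) <= m)%MM.
  by apply/mnm_lepP => j; rewrite mnm1E; case: eqP => // <-.
have [|s es] := IHn (m - U_(i))%MM.
  by rewrite -(submK Ui) mdegD mdeg1 addn1 in dm; case: dm.
exists (enum_val i :: s); rewrite big_cons enum_valK -es.
by rewrite addmC submK.
Qed.

(** The factors of [m], sorted by inclusion and with repetition, have to be the level sets; so v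
    gets as color the index of the first factor containing it, or [mdeg m] if there is none. *)
Lemma level_mnm_surj m :
  {in mnm_supp m &, forall S T : {set 'I_d}, (S \subset T) || (T \subset S)} ->
  exists f : {ffun 'I_d -> 'I_(mdeg m).+1}, m = level_mnm f.
Proof.
have [s es] := mnm_sum_seq m; rewrite {1}es mnm_supp_sumU => tot.
pose sub (S T : {set 'I_d}) := S \subset T.
have subT : transitive sub by move=> ? ? ?; exact: subset_trans.
have ss : sorted sub (sort sub s).
  apply: (sort_sorted_in (P := mem s)); last by apply/allP.
  by move=> S T Ss Ts; apply: tot; rewrite inE.
have sz : size (sort sub s) = mdeg m.
  rewrite size_sort es mdeg_sum (eq_bigr (fun=> 1%N)) ?sum1_size // => S _.
  by rewrite mdeg1.
exists [ffun v => inord (find (fun S : {set 'I_d} => v \in S) (sort sub s))].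
set f := finfun _.
suff -> : level_mnm f = (\sum_(S <- sort sub s) U_(enum_rank S))%MM.
  by rewrite {1}es; apply/perm_big; rewrite perm_sym perm_sort.
rewrite /level_mnm; congr (\big[_/_]_(_ <- _) _).
apply: (eq_from_nth (x0 := set0)); rewrite size_map size_iota ?sz // => i lti.
rewrite (nth_map 0%N) ?size_iota // nth_iota // add0n; apply/setP => v.
rewrite inE ffunE inordK; last by rewrite ltnS -sz find_size.
apply/idP/idP => [le_i|vi].
  have hasv : has (fun S : {set 'I_d} => v \in S) (sort sub s).
    by rewrite has_find (leq_ltn_trans le_i) ?sz.
  apply: (subsetP (_ : sub _ _) _ (nth_find set0 hasv)).
  apply: (sorted_leq_nth subT _ set0 ss) => //; first exact: subxx.
    by rewrite inE sz (leq_ltn_trans le_i).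
  by rewrite inE sz.
by rewrite leqNgt; apply/negP => /(before_find set0); rewrite vi.
Qed.

End LevelMonomials.

(** * Initial segments of the word of a permutation *)

Section Blocks.
Variables (d : nat) (pi : 'S_d).

Lemma mem_block lo hi (p : 'I_d) : (pi p \in block pi lo hi) = (lo <= p < hi)%N.
Proof. by rewrite mem_imset ?inE //; exact: perm_inj. Qed.

Lemma mem_blockV lo hi v : (v \in block pi lo hi) = (lo <= (pi^-1)%g v < hi)%N.
Proof. by rewrite -{1}(permKV pi v) mem_block. Qed.

Lemma block0d : block pi 0 d = setT.
Proof. by apply/setP => v; rewrite mem_blockV ltn_ord inE. Qed.

Lemma block00 : block pi 0 0 = set0.
Proof. by apply/setP => v; rewrite mem_blockV ltn0 inE. Qed.

Lemma blockD c c' : block pi 0 c' :\: block pi 0 c = block pi c c'.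
Proof. by apply/setP => v; rewrite inE !mem_blockV /= -leqNgt. Qed.

Lemma block_proper c c' : (c < c' <= d)%N -> block pi 0 c \proper block pi 0 c'.
Proof.
case/andP=> cc' c'd; apply/properP; split.
  apply/subsetP => v; rewrite !mem_blockV /= => /leq_trans; apply; exact: ltnW.
have cd := leq_trans cc' c'd.
by exists (pi (Ordinal cd)); rewrite mem_block /= ?ltnn.
Qed.

Lemma pairmap_block c cs :
  pairmap (fun S T : {set 'I_d} => T :\: S) (block pi 0 c)
    [seq block pi 0 c' | c' <- cs] = pairmap (block pi) c cs.
Proof. by elim: cs c => //= c' cs IHcs c; rewrite blockD IHcs. Qed.

Lemma path_block c cs : path ltn c (rcons cs d) ->
  path (fun S T : {set 'I_d} => S \proper T) (block pi 0 c)
    (rcons [seq block pi 0 c' | c' <- cs] setT).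
Proof.
elim: cs c => [|c' cs IHcs] c /=.
  by rewrite !andbT => cd; rewrite -block0d block_proper ?cd /=.
case/andP=> cc' pc; rewrite IHcs // block_proper // cc' /=.
have /(order_path_min ltn_trans)/allP/(_ d) := pc.
by rewrite mem_rcons inE eqxx => /(_ isT) /ltnW.
Qed.

(** Each set is the union of its predecessor and the next difference, so the differences determine
    the chain. *)
Lemma pairmap_block_inj c cs (ss : seq {set 'I_d}) :
  path (fun S T : {set 'I_d} => S \proper T) (block pi 0 c) ss ->
  pairmap (fun S T : {set 'I_d} => T :\: S) (block pi 0 c) ss =
    pairmap (block pi) c cs -> path leq c cs ->
  ss = [seq block pi 0 c' | c' <- cs].
Proof.
elim: ss c cs => [|S ss IHss] c [|c' cs] //= /andP[pS pss] [eS ess] /andP[cc' pc].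
have defS : S = block pi 0 c'.
  apply/setP => v; have /setP/(_ v) := eS.
  have := subsetP (proper_sub pS) v; rewrite inE !mem_blockV /= -leqNgt.
  by case: ltnP => [lt_c /(_ isT) -> _|_ _ //]; rewrite (leq_trans lt_c cc').
rewrite /= -defS; congr cons.
by rewrite defS in pss ess *; exact: IHss ess pc.
Qed.

End Blocks.

(** * Basic chains as chains of initial segments ending at cuts *)

Section GSequence.
Variables (d : nat) (adj : rel 'I_d).
Implicit Types pi : 'S_d.
Hypothesis d_gt0 : (0 < d)%N.

(** The first cut is always 0; the others are the right ends of all blocks but the last, that is, of
    the blocks in the short G-sequence. *)
Definition inner_cuts pi : seq nat := behead (cuts adj pi).

Lemma cuts_subseq pi : subseq (cuts adj pi) (iota 0 d).
Proof. by rewrite -val_enum_ord map_subseq // filter_subseq. Qed.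

Lemma cuts_cons pi : cuts adj pi = 0%N :: inner_cuts pi.
Proof.
rewrite /inner_cuts /cuts; move: adj pi d_gt0; case: d => // d' a pi _.
by rewrite enum_ordSl.
Qed.

Lemma inner_cuts_path pi : path ltn 0 (rcons (inner_cuts pi) d).
Proof.
have : subseq (rcons (cuts adj pi) d) (iota 0 d.+1).
  by rewrite -addn1 iotaD -cats1 cat_subseq ?cuts_subseq.
move/(subseq_sorted ltn_trans)/(_ (iota_ltn_sorted _ _)).
by rewrite cuts_cons rcons_cons.
Qed.

Lemma mem_inner_cuts pi (k : 'I_d) :
  (val k \in inner_cuts pi) = (0 < k)%N && cut adj pi k.
Proof.
have memc : (val k \in cuts adj pi) = cut adj pi k.
  by rewrite /cuts (mem_map (@ord_inj d)) mem_filter mem_enum andbT.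
have := inner_cuts_path pi; rewrite rcons_path.
move=> /andP[/(order_path_min ltn_trans)/allP pos _].
rewrite -memc cuts_cons inE; case: (posnP k) => [k0|//].
by apply/negP => /pos /=; rewrite k0.
Qed.

Lemma inner_cuts_lt pi c : c \in inner_cuts pi -> (c < d)%N.
Proof.
move=> cc; have /mem_subseq/(_ c) := cuts_subseq pi.
by rewrite mem_iota cuts_cons inE cc orbT => /(_ isT).
Qed.

Lemma short_G_sequenceE pi :
  short_G_sequence adj pi = pairmap (block pi) 0 (inner_cuts pi).
Proof.
rewrite /short_G_sequence /G_sequence size_map size_iota cuts_cons [_.-1]/=.
set cs := inner_cuts pi.
set ss := map _ _.
have sz : size (take (size cs) ss) = size cs.
  by rewrite size_takel // size_map size_iota.
apply: (@eq_from_nth _ set0); first by rewrite sz size_pairmap.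
rewrite sz => i lti; rewrite nth_take // (nth_map 0%N) ?size_iota ?ltnS 1?ltnW //.
rewrite nth_iota ?ltnS 1?ltnW //.
by rewrite (nth_pairmap d).
Qed.

Lemma basic_chainP (ss : seq {set 'I_d}) :
  basic_chain adj ss <->
  exists pi, ss = [seq block pi 0 c | c <- inner_cuts pi].
Proof.
split=> [/andP[pss /existsP[pi /eqP]]|[pi ->]].
  rewrite short_G_sequenceE => e; exists pi.
  rewrite rcons_path in pss; case/andP: pss => pss _.
  apply: (@pairmap_block_inj _ pi 0%N); rewrite ?block00 //.
  have := inner_cuts_path pi; rewrite rcons_path => /andP[p _].
  by apply: sub_path p => x y /ltnW.
apply/andP; split.
  by rewrite -(block00 pi) path_block // inner_cuts_path.
by apply/existsP; exists pi; rewrite short_G_sequenceE -(block00 pi) pairmap_block.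
Qed.

End GSequence.

(** * Longest paths in a relation *)

Section LongestPath.
Variables (N : nat) (T : finType).
Implicit Types (R : rel T) (x : T) (s : seq T).

(** The formula of [ell] for an arbitrary relation, so that paths through positions can be compared
    with paths through vertices. *)
Definition longest R x : nat :=
  \max_(r < N | [exists x0 : T, exists s : r.-tuple T,
                   path R x0 s && (last x0 s == x)]) r.

Lemma longest_ub R x0 s :
  path R x0 s -> (size s < N)%N -> (size s <= longest R (last x0 s))%N.
Proof.
move=> ps szs; apply: (leq_bigmax_cond (Ordinal szs)).
by apply/existsP; exists x0; apply/existsP; exists (in_tuple s); rewrite ps eqxx.
Qed.

Lemma longest_path R x : (0 < N)%N ->
  exists x0, exists2 s, path R x0 s & last x0 s = x /\ size s = longest R x.
Proof.
move=> N0; pose P (r : 'I_N) := [exists x0 : T, exists s : r.-tuple T,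
                   path R x0 s && (last x0 s == x)].
have [|r Pr er] := @eq_bigmax_cond _ P (fun r : 'I_N => nat_of_ord r).
  apply/card_gt0P; exists (Ordinal N0).
  by apply/existsP; exists x; apply/existsP; exists [tuple]; rewrite /= eqxx.
case/existsP: (Pr) => x0 /existsP[s /andP[ps /eqP ls]].
by exists x0; exists s => //; rewrite size_tuple /longest er.
Qed.

Lemma longest_lt R x : (0 < N)%N -> (longest R x < N)%N.
Proof.
move=> N0; rewrite -(ltn_predK N0) ltnS; apply/bigmax_leqP => r _.
by rewrite -ltnS (ltn_predK N0).
Qed.

End LongestPath.

Lemma longest_mono N (T T' : finType) (R : rel T) (R' : rel T') (h : T -> T') x :
  (0 < N)%N -> {mono h : x y / R x y >-> R' x y} ->
  (longest N R x <= longest N R' (h x))%N.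
Proof.
move=> N0 hR; have [x0 [s ps [<- sz]]] := longest_path R x N0.
rewrite -{1}sz -(size_map h) -last_map; apply: longest_ub.
  by rewrite (mono_path hR).
by rewrite size_map sz longest_lt.
Qed.

(** * Cuts between adjacent letters *)

Section Cuts.
Variables (d : nat) (adj : rel 'I_d) (pi : 'S_d).
Hypothesis d_gt0 : (0 < d)%N.

Lemma ellE k :
  ell adj pi k = longest d (fun i j : 'I_d => (i < j)%N && adj (pi i) (pi j)) k.
Proof. by []. Qed.

(* Hence, ell being nonincreasing inside a block, adjacent letters lie in
   different blocks. *)
Lemma ell_lt (p q : 'I_d) :
  (p < q)%N -> adj (pi p) (pi q) -> (ell adj pi p < ell adj pi q)%N.
Proof.
move=> pq apq; rewrite !ellE; set R := (fun i j : 'I_d => _).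
have [x0 [s ps [ls <-]]] := longest_path R p d_gt0.
have psq : path R x0 (rcons s q) by rewrite rcons_path ps ls /R pq.
have := longest_ub (N := d) psq; rewrite last_rcons size_rcons; apply.
(* [longest] only sees paths of length below d; the positions increase along the path, so they are
   distinct and the bound holds. *)
have : sorted ltn [seq val i | i <- x0 :: rcons s q].
  by rewrite sorted_map; apply: sub_path psq => i j /andP[].
move/(sorted_uniq ltn_trans ltnn); rewrite map_inj_uniq; last exact: val_inj.
move/card_uniqP; rewrite /= size_rcons => <-.
by rewrite -[X in (_ <= X)%N]card_ord max_card.
Qed.

(** Descent from q: if there is no cut at q, then [ell] does not increase from q - 1 to q, and the
    inequality already holds at q - 1. *)
Lemma cut_between (p q : 'I_d) :
  (p < q)%N -> (ell adj pi p < ell adj pi q)%N ->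
  exists2 c, c \in inner_cuts adj pi & (p < c <= q)%N.
Proof.
move: {2}(nat_of_ord q) (erefl (nat_of_ord q)) => q'.
elim: q' q => [|q' IHq] q eq pq lpq; first by rewrite eq in pq.
have [cq|ncq] := boolP (cut adj pi q).
  exists (val q); last by rewrite pq leqnn.
  by rewrite (mem_inner_cuts _ d_gt0) cq andbT (leq_ltn_trans _ pq).
have lt_q' : (q' < d)%N by rewrite -ltnS -[X in (X < _)%N]eq ltnS ltnW.
pose j := Ordinal lt_q'.
have le_qj : (ell adj pi q <= ell adj pi j)%N.
  rewrite leqNgt; apply: contra ncq => ljq; apply/orP; right.
  by apply/existsP; exists j; rewrite ljq /= eq eqxx.
have pj : (p < j)%N.
  rewrite ltn_neqAle -ltnS [in X in _ && X]/= -eq pq andbT.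
  apply: contraTneq lpq => /val_inj ->; by rewrite -leqNgt.
have [c ci /andP[pc cj]] := IHq j erefl pj (leq_trans lpq le_qj).
by exists c => //; rewrite pc eq ltnW.
Qed.

End Cuts.

(** * Proper colorings and basic chains among level sets *)

Section ProperColorings.
Variables (d : nat) (adj : rel 'I_d).
Hypotheses (d_gt0 : (0 < d)%N) (adj_sym : symmetric adj) (adj_irr : irreflexive adj).

Definition proper_coloring n (f : {ffun 'I_d -> 'I_n}) : bool :=
  [forall x, forall y, adj x y ==> (f x != f y)].

(** Two adjacent letters are separated by a cut. The initial segment ending there is a level set of
    f containing only the earlier letter, so the colors differ. *)
Lemma proper_of_basic n (f : {ffun 'I_d -> 'I_n.+1}) ss :
  basic_chain adj ss -> {subset ss <= levels f} -> proper_coloring f.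
Proof.
move=> /(basic_chainP _ d_gt0)[pi ->] sub.
apply/forallP => x; apply/forallP => y; apply/implyP.
rewrite -(permKV pi x) -(permKV pi y).
move: (_ x) (_ y) => {x y}p q.
wlog pq : p q / (p < q)%N.
  case: (ltngtP p q) => [pq|qp|/val_inj ->]; last by rewrite adj_irr.
    exact.
  by rewrite adj_sym eq_sym; move=> H; exact: H.
move=> apq; have [c ci /andP[pc cq]] := cut_between d_gt0 pq (ell_lt d_gt0 pq apq).
have /sub/mapP[i _ ei] := map_f (block pi 0) ci.
have := mem_block pi 0 c p; have := mem_block pi 0 c q.
rewrite ei !inE pc leq0n /= ltnNge cq /= => fq fp.
by apply: contraFneq fq => <-.
Qed.

Section ColoringOrder.
Variables (n : nat) (f : {ffun 'I_d -> 'I_n}) (lam : 'I_d -> nat).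

(* Sorted by this order, a proper coloring f whose longest f-increasing adj-paths
   have length lam has no cut inside a color class: there ell = lam does not
   increase, and the labels decrease where it is constant. *)
Definition coloring_le (x y : 'I_d) : bool :=
  (f x < f y)%N ||
  (f x == f y :> nat) && ((lam y < lam x)%N || (lam y == lam x) && (y <= x)%N).

Lemma coloring_le_refl : reflexive coloring_le.
Proof. by move=> x; rewrite /coloring_le !eqxx leqnn !orbT. Qed.

Lemma coloring_le_trans : transitive coloring_le.
Proof. move=> y x z; rewrite /coloring_le; lia. Qed.

Lemma coloring_le_total : total coloring_le.
Proof. move=> x y; rewrite /coloring_le; lia. Qed.

Lemma coloring_perm : exists pi : 'S_d,
  forall p q : 'I_d, (p <= q)%N -> coloring_le (pi p) (pi q).
Proof.
pose s := sort coloring_le (enum 'I_d).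
have szs : size s = d by rewrite size_sort size_enum_ord.
have injs : injective (fun p : 'I_d => nth p s p).
  move=> p q; rewrite (set_nth_default p q) ?szs // => /eqP.
  by rewrite nth_uniq ?szs ?sort_uniq ?enum_uniq // => /eqP /val_inj.
exists (perm injs) => p q pq; rewrite !permE (set_nth_default p q) ?szs //.
apply: (sorted_leq_nth coloring_le_trans coloring_le_refl p) => //.
- exact: sort_sorted coloring_le_total _.
- by rewrite inE szs.
- by rewrite inE szs.
Qed.

End ColoringOrder.

Lemma basic_of_proper n (f : {ffun 'I_d -> 'I_n.+1}) :
  proper_coloring f -> exists2 ss, basic_chain adj ss & {subset ss <= levels f}.
Proof.
move=> pf; pose R x y := (f x < f y)%N && adj x y.
have [pi le_pi] := coloring_perm f (longest d R).
have f_pi (p q : 'I_d) : (p <= q)%N -> (f (pi p) <= f (pi q))%N.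
  by move/le_pi => /orP[/ltnW|/andP[/eqP->]].
(* As f is proper, color order and position order agree along an edge; this identifies [ell] with
   the path length used for sorting. *)
have piR (p q : 'I_d) : R (pi p) (pi q) = (p < q)%N && adj (pi p) (pi q).
  rewrite /R; case: (boolP (adj _ _)) => [apq|]; rewrite ?andbF // !andbT.
  have fpq : f (pi p) != f (pi q) :> nat.
    by have /forallP/(_ (pi p))/forallP/(_ (pi q)) := pf; rewrite apq.
  apply/idP/idP => [|/ltnW/f_pi]; last by rewrite leq_eqVlt (negPf fpq).
  by rewrite !ltnNge; apply: contra => /f_pi.
have ell_pi p : ell adj pi p = longest d R (pi p).
  apply/eqP; rewrite eqn_leq ellE longest_mono //= -{2}(permK pi p).
  by apply: longest_mono => // x y; rewrite -piR !permKV.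
exists [seq block pi 0 c | c <- inner_cuts adj pi].
  by apply/(basic_chainP _ d_gt0); exists pi.
move=> S /mapP[c cc ->]; have cd := inner_cuts_lt d_gt0 cc.
move: cc; rewrite -[c]/(val (Ordinal cd)) (mem_inner_cuts _ d_gt0).
move: (Ordinal cd) => {cd}k /andP[k0 /orP[/eqP|/existsP[j /andP[/eqP jk]]]].
  by move=> e; rewrite e in k0.
rewrite !ell_pi => cutk.
have fjk : (f (pi j) < f (pi k))%N.
  have := le_pi j k; rewrite -jk leqnSn => /(_ isT) /orP[//|/andP[_]].
  by move: cutk; lia.
have -> : block pi 0 k = level f (f (pi j)).
  apply/setP => v; rewrite -(permKV pi v) mem_block inE /=.
  apply/idP/idP => [|]; first by rewrite -jk ltnS => /f_pi.
  by rewrite !ltnNge; apply: contraL => /f_pi; rewrite -ltnNge; exact: leq_trans.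
(* Only L_0, ..., L_(n-1) are listed; the jump in color at k gives f (pi j) < f (pi k) <= n. *)
rewrite map_f // mem_iota /= add0n; apply: leq_trans fjk _.
by rewrite -ltnS.
Qed.

End ProperColorings.

(** * The coloring ideal as a span of monomials *)

Section ColoringIdeal.
Variables (k : fieldType) (d : nat) (adj : rel 'I_d).
Implicit Type C : {set {set 'I_d}}.

Lemma up_closed_nonface : up_closed (fun C => ~ coloring_complex adj C).
Proof.
move=> C C' /subsetP sub nC [tot nb]; apply: nC; split.
  by move=> S T /sub S' /sub T'; exact: tot.
by move=> ss bss sC; apply: (nb ss bss) => S /sC /sub.
Qed.

Lemma boolean_ideal_ideal : is_ideal (@boolean_ideal d k).
Proof. exact: ideal_genP. Qed.

Lemma coloring_ideal_ideal : is_ideal (coloring_ideal adj k).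
Proof. exact: ideal_modP boolean_ideal_ideal. Qed.

Lemma basic_chain_uniq ss : basic_chain adj ss -> uniq ss.
Proof.
case/andP=> + _; rewrite rcons_path => /andP[/path_sorted + _].
by apply: sorted_uniq => [S T U|S]; [exact: proper_trans|rewrite properxx].
Qed.

(** A support is a nonface for one of two reasons: it has incomparable members, and the monomial is
    a multiple of a Boolean relation; or it contains a basic chain, and the monomial is a multiple
    of a basic coloring monomial. *)
Lemma coloring_ideal_monomial p :
  coloring_ideal adj k p <->
  monomial_ideal (fun C => ~ coloring_complex adj C) p.
Proof.
have idJ := monomial_ideal_ideal k up_closed_nonface.
split.
  move=> [q Kq Iq]; rewrite -(subrK q p); case: (idJ) => _ + _; apply.
    apply: ideal_gen_sub Iq => // _ [S [T [nST nTS ->]]].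
    have -> : xvar k S * xvar k T = \prod_(U <- [:: S; T]) xvar k U.
      by rewrite big_cons big_seq1.
    rewrite prod_xvar; apply: monomial_idealX; rewrite mnm_supp_sumU.
    case=> /(_ S T) + _; rewrite !inE !eqxx orbT => /(_ isT isT).
    by rewrite (negPf nST) (negPf nTS).
  apply: ideal_gen_sub Kq => // _ [ss bss ->].
  rewrite prod_xvar; apply: monomial_idealX; rewrite mnm_supp_sumU.
  by case=> _ /(_ ss bss); apply => S; rewrite inE.
apply: monomial_ideal_sub; first exact: coloring_ideal_ideal.
move=> m nm; have [[S [T [Sm Tm nST nTS]]]|comp] := pselect (exists S T : {set 'I_d},
    [/\ S \in mnm_supp m, T \in mnm_supp m, ~~ (S \subset T) & ~~ (T \subset S)]).
  exists 0; first exact: ideal_gen0.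
  have [||a ->] := @monomial_dvd k _ [:: S; T] m.
  - by rewrite /= inE andbT; apply: contraNneq nST => ->.
  - by move=> U; rewrite !inE => /orP[]/eqP->; [move: Sm|move: Tm]; rewrite inE.
  rewrite subr0 big_cons big_seq1; apply: ideal_genM.
  exists [:: (1, xvar k S * xvar k T)]; last by rewrite big_seq1 mul1r.
  by move=> q; rewrite inE => /eqP ->; exists S, T.
have [ss bss sm] : exists2 ss, basic_chain adj ss & {subset ss <= mnm_supp m}.
  apply: contrapT => nss; apply: nm; split=> [S T Sm Tm|ss bss sm].
    apply/negPn/negP; rewrite negb_or => /andP[nST nTS].
    by apply: comp; exists S, T.
  by apply: nss; exists ss.
exists 'X_[m]; last by rewrite subrr; case: boolean_ideal_ideal.
have [a ->] := monomial_dvd k (basic_chain_uniq bss) sm.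
apply: ideal_genM.
exists [:: (1, \prod_(S <- ss) xvar k S)]; last by rewrite big_seq1 mul1r.
by move=> q; rewrite inE => /eqP ->; exists ss.
Qed.

End ColoringIdeal.

(** * Hilbert functions count improper colorings *)

Section HilbertColoring.
Variables (k : fieldType) (d : nat) (adj : rel 'I_d).
Hypotheses (d_gt0 : (0 < d)%N) (adj_sym : symmetric adj) (adj_irr : irreflexive adj).

Definition nonproper n : nat :=
  #|[pred f : {ffun 'I_d -> 'I_n} | ~~ proper_coloring adj f]|.

Lemma coloring_complex_level n (f : {ffun 'I_d -> 'I_n.+1}) :
  coloring_complex adj (mnm_supp (level_mnm f)) <-> ~~ proper_coloring adj f.
Proof.
rewrite mnm_supp_level_mnm; split=> [[_ nb]|npf].
  apply/negP => /(basic_of_proper d_gt0)[ss bss sub].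
  by apply: (nb ss bss) => S /sub; rewrite inE.
split=> [S T|ss bss sub].
  rewrite !inE => /mapP[i _ ->] /mapP[j _ ->].
  by case: (leqP i j) => [/(level_chain f)->//|/ltnW/(level_chain f)->]; rewrite orbT.
apply/negP: npf; rewrite negbK.
by apply: (proper_of_basic d_gt0 adj_sym adj_irr bss) => S /sub; rewrite inE.
Qed.

(** [J] is kept general to cover both K_G and the face ideal. A monomial of degree n encodes a
    coloring with n + 1 colors, whence the shift by one. *)
Lemma hilbert_nonproper (J : {mpoly k[#|{set 'I_d}|]} -> Prop) n :
  is_ideal J ->
  (forall p, J p <-> monomial_ideal (fun C => ~ coloring_complex adj C) p) ->
  hilbert J n = nonproper n.+1.
Proof.
move=> idJ JP; apply: (quot_dim_uniq idJ (hilbertP idJ n)).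
have -> : nonproper n.+1 =
    #|{: {f : {ffun 'I_d -> 'I_n.+1} | ~~ proper_coloring adj f}}|.
  by rewrite card_sig.
apply: (@quot_dim_monomial _ _ J (fun m => ~ coloring_complex adj (mnm_supp m)) n _
          (fun f => level_mnm (val f))) => //.
- by move=> f g /level_mnm_inj /val_inj.
- by move=> f; exact: mdeg_level_mnm.
- by move=> f; apply; apply/coloring_complex_level; exact: (valP f).
- move=> m dm /contrapT face; have [tot _] := face.
  have := level_mnm_surj tot; rewrite dm => -[f mf].
  have npf : ~~ proper_coloring adj f by apply/coloring_complex_level; rewrite -mf.
  by exists (Sub f npf); rewrite SubK.
Qed.

Lemma hilbert_coloring_ideal n :
  hilbert (coloring_ideal adj k) n = nonproper n.+1.
Proof.
by apply: hilbert_nonproper; [exact: coloring_ideal_ideal|exact: coloring_ideal_monomial].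
Qed.

Lemma hilbert_coloring_complex n :
  hilbert (face_ideal (k := k) (coloring_complex adj)) n = nonproper n.+1.
Proof.
apply: hilbert_nonproper; first exact: ideal_genP.
by move=> p; exact/face_ideal_monomial/up_closed_nonface.
Qed.

End HilbertColoring.

(** * Counting colorings by their kernel *)

Section Kernels.
Variable d : nat.

(* The value chosen by [pick] depends on the predicate only up to
   extensionality, so [kernel f] determines the partition of the domain into
   fibers of f and is determined by it. *)
Definition kernel n (f : {ffun 'I_d -> 'I_n}) : {ffun 'I_d -> 'I_d} :=
  [ffun x => odflt x [pick y | f y == f x]].

Lemma kernelK n (f : {ffun 'I_d -> 'I_n}) x : f (kernel f x) = f x.
Proof. by rewrite ffunE; case: pickP => [y /eqP|]. Qed.

Lemma kernel_eq n (f : {ffun 'I_d -> 'I_n}) x y :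
  (kernel f x == kernel f y) = (f x == f y).
Proof.
apply/eqP/eqP => [e|e]; first by rewrite -(kernelK f x) e kernelK.
rewrite !ffunE; under eq_pick do rewrite e.
by case: pickP => // /(_ y); rewrite eqxx.
Qed.

Lemma eq_kernel n n' (f : {ffun 'I_d -> 'I_n}) (g : {ffun 'I_d -> 'I_n'}) :
  (forall x y, (f x == f y) = (g x == g y)) -> kernel f = kernel g.
Proof. by move=> fg; apply/ffunP => x; rewrite !ffunE; under eq_pick do rewrite fg. Qed.

Lemma kernel_idem n (f : {ffun 'I_d -> 'I_n}) : kernel (kernel f) = kernel f.
Proof. exact: eq_kernel (kernel_eq f). Qed.

(** When r is a kernel, its fixed points are the chosen representatives, so this is the number of
    fibers. *)
Definition nfix (r : {ffun 'I_d -> 'I_d}) : nat := #|[pred x | r x == x]|.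

Lemma nfix_kernel n (f : {ffun 'I_d -> 'I_n}) : nfix (kernel f) = #|f @: 'I_d|.
Proof.
have -> : f @: 'I_d = f @: [set x | kernel f x == x].
  apply/setP => v; apply/imsetP/imsetP => [[x _ ->]|[x _ ->]]; last by exists x.
  by exists (kernel f x); rewrite ?inE ?kernelK // kernel_eq kernelK.
rewrite card_in_imset ?cardsE // => x y; rewrite !inE => /eqP ex /eqP ey /eqP.
by rewrite -kernel_eq ex ey => /eqP.
Qed.

(** A coloring with kernel r amounts to an injective coloring of the fixed points of r, one for each
    fiber. *)
Lemma card_kernel n (r : {ffun 'I_d -> 'I_d}) : kernel r = r ->
  #|[pred f : {ffun 'I_d -> 'I_n} | kernel f == r]| = (n ^_ (nfix r))%N.
Proof.
move=> rr; pose U := {x | r x == x}.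
have rU x : r (r x) == r x by have := kernelK r x; rewrite rr => ->.
pose q x : U := exist _ (r x) (rU x).
have qval u : q (val u) = u by apply: val_inj; exact/eqP/(valP u).
have eq_q x y : (q x == q y) = (r x == r y) by [].
pose F (g : {ffun U -> 'I_n}) := [ffun x => g (q x)].
have injF : injective F.
  by move=> g g' /ffunP gg'; apply/ffunP => u; have := gg' (val u); rewrite !ffunE qval.
have -> : nfix r = #|{: U}| by rewrite card_sig; apply: eq_card => x; rewrite !inE.
rewrite -[X in (X ^_ _)%N]card_ord -card_inj_ffuns -(card_imset _ injF).
apply: eq_card => f; rewrite !inE; apply/eqP/imsetP => [kf|[g]].
  exists [ffun u => f (val u)].
    rewrite inE; apply/injectiveP => u v; rewrite !ffunE => /eqP.
    by rewrite -kernel_eq kf (eqP (valP u)) (eqP (valP v)) => /eqP /val_inj.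
  by apply/ffunP => x; rewrite !ffunE /= -kf kernelK.
rewrite inE => /injectiveP injg ->; rewrite -[RHS]rr; apply: eq_kernel => x y.
by rewrite !ffunE (inj_eq injg) eq_q.
Qed.

End Kernels.

(** * Falling factorials as polynomials *)

Section FallingFactorials.

Definition ffact_poly (m : nat) : {poly int} :=
  \prod_(0 <= i < m) ('X - (i%:R)%:P).

Lemma ffact_polyE m n : (ffact_poly m).[n%:R] = (n ^_ m)%:R.
Proof.
elim: m => [|m IHm]; first by rewrite /ffact_poly big_geq // hornerC.
rewrite /ffact_poly big_nat_recr //= hornerM IHm hornerXsubC ffactnSr natrM.
by case: (leqP m n) => [mn|nm]; [rewrite natrB|rewrite ffact_small // !mul0r].
Qed.

Lemma size_ffact_poly m : size (ffact_poly m) = m.+1.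
Proof. by rewrite size_prod_XsubC size_iota subn0. Qed.

Lemma lead_ffact_poly m : (ffact_poly m)`_m = 1.
Proof.
have /monicP := monic_prod_XsubC (index_iota 0 m) xpredT (fun i : nat => i%:R : int).
by rewrite /lead_coef -/(ffact_poly m) size_ffact_poly.
Qed.

End FallingFactorials.

(** * Multiplying a power series by a power of 1 - t *)

Section Convolution.
Implicit Types (a b : nat -> int) (D n : nat).

Definition conv D a n : int :=
  \sum_(i < n.+1) ((1 - 'X : {poly int}) ^+ D)`_i * a (n - i)%N.

Lemma eq_conv D a b : a =1 b -> conv D a =1 conv D b.
Proof. by move=> ab n; apply: eq_bigr => i _; rewrite ab. Qed.

Lemma conv0 D n : conv D (fun=> 0) n = 0.
Proof. by rewrite /conv big1 // => i _; rewrite mulr0. Qed.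

Lemma conv_sum (I : finType) (P : pred I) (c : I -> int) (a : I -> nat -> int) D n :
  conv D (fun n => \sum_(i | P i) c i * a i n) n = \sum_(i | P i) c i * conv D (a i) n.
Proof.
rewrite /conv; under eq_bigr do rewrite mulr_sumr.
rewrite exchange_big; apply: eq_bigr => i _; rewrite mulr_sumr.
by apply: eq_bigr => j _; rewrite mulrCA.
Qed.

Definition shift a n : int := if n is n'.+1 then a n' else 0.

Lemma conv_shift D a n : conv D (shift a) n.+1 = conv D a n.
Proof.
rewrite /conv big_ord_recr /= subnn mulr0 addr0.
by apply: eq_bigr => i _; rewrite subSn //= -ltnS.
Qed.

Lemma convS D a n : conv D.+1 a n = conv D (fun n => a n - shift a n) n.
Proof.
pose A := \poly_(i < n.+1) a i.
have AE i : (i <= n)%N -> A`_i = a i by rewrite coef_poly ltnS => ->.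
have -> : conv D.+1 a n = ((1 - 'X) ^+ D.+1 * A)`_n.
  by rewrite coefM; apply: eq_bigr => i _; rewrite AE ?leq_subr.
rewrite exprSr -mulrA coefM; apply: eq_bigr => i _; congr (_ * _).
rewrite mulrBl mul1r coefB coefXM AE ?leq_subr //.
have : (n - i <= n)%N by rewrite leq_subr.
by case: (n - i)%N => // j jn; rewrite /= AE // ltnW.
Qed.

Lemma size_1subX_exp e : (size ((1 - 'X : {poly int}) ^+ e) <= e.+1)%N.
Proof.
have s2 : size (1 - 'X : {poly int}) = 2 by rewrite -opprB size_polyN size_XsubC.
by have := size_exp_leq (1 - 'X : {poly int}) e; rewrite s2 mul1n.
Qed.

(** The series of C(n, m) is t^m / (1 - t)^(m + 1), so the product with (1 - t)^D is t^m (1 - t)^(D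
    - m - 1), of degree D - 1. In the induction, one factor 1 - t takes a backward difference, which
    by Pascal's rule is a shift of the case m - 1. *)
Lemma conv_bin m D n : (m < D <= n)%N -> conv D (fun n => 'C(n, m)%:R) n = 0.
Proof.
elim: m D n => [|m IHm] [|D] [|n]; rewrite ?ltn0 ?andbF ?ltnS // => /andP[mD Dn].
  rewrite convS (@eq_conv D _ (fun n => (n == 0%N)%:R)); last first.
    by move=> [|j]; rewrite /= !bin0 ?subr0 ?subrr.
  rewrite /conv big_ord_recr /= subnn mulr1 big1 => [|i _]; last first.
    by rewrite subSn ?mulr0 // -ltnS.
  by rewrite add0r nth_default // (leq_trans (size_1subX_exp D)) ?ltnS.
rewrite convS (@eq_conv D _ (shift (fun n => 'C(n, m)%:R))); last first.
  by move=> [|j]; rewrite /= ?bin0n ?subr0 // binS natrD addrAC subrr add0r.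
by rewrite conv_shift IHm ?mD.
Qed.

End Convolution.

(** * The tail as a sum of falling factorials *)

Section Tail.
Variables (d : nat) (adj : rel 'I_d).
Hypotheses (d_gt0 : (0 < d)%N) (adj_irr : irreflexive adj).

Lemma chromatic_tailE n : chromatic_tail adj n = (nonproper adj n)%:Z.
Proof.
have := cardC [pred f : {ffun 'I_d -> 'I_n} | proper_coloring adj f].
rewrite card_ffun !card_ord /chromatic_tail /chi cardsE => <-.
by rewrite PoszD addrAC subrr add0r.
Qed.

Lemma nonproper0 : nonproper adj 0 = 0%N.
Proof.
by apply/eqP; rewrite -leqn0 (leq_trans (max_card _)) // card_ffun !card_ord exp0n.
Qed.

Lemma proper_kernel n (f : {ffun 'I_d -> 'I_n}) :
  proper_coloring adj (kernel f) = proper_coloring adj f.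
Proof.
by apply: eq_forallb => x; apply: eq_forallb => y; rewrite kernel_eq.
Qed.

Definition nonproper_kernel (r : {ffun 'I_d -> 'I_d}) : bool :=
  (kernel r == r) && ~~ proper_coloring adj r.

Lemma nonproperE n :
  nonproper adj n = (\sum_(r | nonproper_kernel r) n ^_ (nfix r))%N.
Proof.
rewrite /nonproper -sum1_card (partition_big (@kernel d n) nonproper_kernel) /=.
  apply: eq_bigr => r /andP[/eqP rr npr]; rewrite -card_kernel // -sum1_card.
  apply: eq_bigl => f; rewrite !inE andbC; case: eqP => //= fr.
  by rewrite -proper_kernel fr.
by move=> f npf; rewrite /nonproper_kernel kernel_idem eqxx proper_kernel.
Qed.

Lemma nonproper_card_image n (f : {ffun 'I_d -> 'I_n}) :
  ~~ proper_coloring adj f -> (#|f @: 'I_d| < d)%N.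
Proof.
case/forallPn => x /forallPn[y]; rewrite negb_imply negbK => /andP[axy /eqP fxy].
have xy : x != y by apply: contraTneq axy => ->; rewrite adj_irr.
have -> : f @: 'I_d = f @: [set~ y].
  apply/setP => v; apply/imsetP/imsetP => -[z]; last by exists z.
  move=> _ ->; case: (eqVneq z y) => [->|zy]; last by exists z; rewrite ?inE.
  by exists x; rewrite ?inE.
rewrite (leq_ltn_trans (leq_imset_card _ _)) //.
by rewrite cardsC1 card_ord ltn_predL.
Qed.

Lemma nfix_nonproper r : nonproper_kernel r -> (nfix r < d)%N.
Proof. by case/andP=> /eqP rr npr; rewrite -rr nfix_kernel nonproper_card_image. Qed.

Definition tail_poly : {poly int} :=
  \sum_(r | nonproper_kernel r) ffact_poly (nfix r).

Lemma tail_polyE n : tail_poly.[n%:R] = chromatic_tail adj n.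
Proof.
rewrite chromatic_tailE nonproperE -[RHS]natz natr_sum horner_sum.
by apply: eq_bigr => r _; rewrite ffact_polyE.
Qed.

(** A falling factorial is m! C(i, m), and m < d for every improper kernel, so [conv_bin] kills each
    term. *)
Lemma conv_nonproper n : (d <= n)%N ->
  conv d (fun i => (nonproper adj i)%:Z) n = 0.
Proof.
move=> dn; rewrite (@eq_conv d _ (fun i => \sum_(r | nonproper_kernel r)
    ((nfix r)`!%:R : int) * 'C(i, nfix r)%:R)); last first.
  move=> i; rewrite nonproperE -natz natr_sum; apply: eq_bigr => r _.
  by rewrite -natrM mulnC bin_ffact.
rewrite (conv_sum _ _ (fun r i => 'C(i, nfix r)%:R)) big1 // => r /nfix_nonproper fr.
by rewrite conv_bin ?mulr0 ?fr.
Qed.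

(** For an edge xy this is an improper coloring with the largest possible number d - 1 of colors; it
    yields the exact degree of the tail and a facet of the complex. *)
Definition merge (x y : 'I_d) : {ffun 'I_d -> 'I_d} :=
  [ffun z => if z == y then x else z].

Lemma nonproper_merge x y : adj x y -> nonproper_kernel (kernel (merge x y)).
Proof.
move=> axy; rewrite /nonproper_kernel kernel_idem eqxx proper_kernel.
apply/forallPn; exists x; apply/forallPn; exists y.
by rewrite axy !ffunE eqxx if_same eqxx.
Qed.

Lemma nfix_merge x y : x != y -> nfix (kernel (merge x y)) = d.-1.
Proof.
move=> xy; rewrite nfix_kernel (_ : _ @: _ = [set~ y]) ?cardsC1 ?card_ord //.
apply/setP => v; rewrite !inE; apply/imsetP/idP => [[z _ ->]|vy].
  by rewrite ffunE; case: (eqVneq z y).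
by exists v; rewrite ?ffunE ?(negPf vy).
Qed.

(** The summands are monic of degree below d, so those of degree d - 1 cannot cancel, and an edge
    provides one. The exponent in the W-transform is therefore d. *)
Lemma size_tail_poly x y : adj x y -> size tail_poly = d.
Proof.
move=> axy; have xy : x != y by apply: contraTneq axy => ->; rewrite adj_irr.
apply/eqP; rewrite eqn_leq; apply/andP; split.
  apply: (leq_trans (size_sum _ _ _)); apply/bigmax_leqP => r /nfix_nonproper.
  by rewrite size_ffact_poly.
rewrite -(ltn_predK d_gt0) ltnNge; apply/negP => /leq_sizeP/(_ _ (leqnn _)).
rewrite /tail_poly coef_sum.
rewrite (eq_bigr (fun r => (nfix r == d.-1)%:R)) => [|r /nfix_nonproper fr]; last first.
  case: eqP => [<-|ne]; first exact: lead_ffact_poly.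
  by rewrite nth_default // size_ffact_poly ltn_neqAle (introN eqP ne) -ltnS (ltn_predK d_gt0).
rewrite (bigD1 (kernel (merge x y))) ?nonproper_merge //= nfix_merge // eqxx.
by move/eqP; rewrite -natr_sum -natrD Num.Theory.pnatr_eq0.
Qed.

Lemma nonproper_noedge n : (forall x y, adj x y = false) -> nonproper adj n = 0%N.
Proof.
move=> na; apply: eq_card0 => f; rewrite inE; apply/negbTE; rewrite negbK.
by apply/forallP => x; apply/forallP => y; rewrite na.
Qed.

End Tail.

(** * Dimension of the coloring complex *)

Section Dimension.
Variables (d : nat) (adj : rel 'I_d).
Hypotheses (d_gt0 : (0 < d)%N) (adj_sym : symmetric adj) (adj_irr : irreflexive adj).

(** If L_i and L_(i+1) differ, some vertex has color i + 1; so n distinct level sets force the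
    colors 1, ..., n - 1 to occur. *)
Lemma level_inj_card_image n (f : {ffun 'I_d -> 'I_n.+1}) :
  uniq (levels f) -> (n <= #|f @: 'I_d|.+1)%N.
Proof.
move=> uf; case: n f uf => // n f uf; rewrite ltnS.
pose g (i : 'I_n) : 'I_n.+2 := inord i.+1.
have gE i : g i = i.+1 :> nat by rewrite inordK // !ltnS ltnW.
have injg : injective g by move=> i j /(congr1 val) /=; rewrite !gE => -[/val_inj].
rewrite -[X in (X <= _)%N]card_ord -(card_imset _ injg); apply: subset_leq_card.
apply/subsetP => _ /imsetP[i _ ->].
have lt1 : (i < size (levels f))%N by rewrite size_map size_iota ltnW // ltnS.
have lt2 : (i.+1 < size (levels f))%N by rewrite size_map size_iota ltnS.
have := nth_uniq set0 lt1 lt2 uf; rewrite ltn_eqF //.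
rewrite !(nth_map 0%N) ?size_iota ?nth_iota ?add0n //; try by rewrite ?ltnS // ltnW ?ltnS.
move/negbT/eqP=> ne; apply/imsetP; apply: contrapT => nim; apply: ne.
apply/setP => v; rewrite !inE [RHS]leq_eqVlt ltnS.
case: eqP => // fv; case: nim; exists v => //; apply: val_inj.
by rewrite /= fv -gE.
Qed.

Lemma uniq_levels n (f : {ffun 'I_d -> 'I_n.+1}) :
  #|mnm_supp (level_mnm f)| = n -> uniq (levels f).
Proof.
rewrite mnm_supp_level_mnm cardsE => cf.
by apply/card_uniqP; rewrite cf size_map size_iota.
Qed.

(** The product over a face encodes an improper coloring with distinct level sets, whose image has
    fewer than d colors. *)
Lemma coloring_complex_card C : coloring_complex adj C -> (#|C| <= d)%N.
Proof.
move=> fC; pose m := (\sum_(S <- enum C) U_(enum_rank S))%MM.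
have sm : mnm_supp m = C.
  by rewrite mnm_supp_sumU; apply/setP => S; rewrite inE mem_enum.
have dm : mdeg m = #|C|.
  by rewrite mdeg_sum (eq_bigr (fun=> 1%N)) ?sum1_size ?cardE // => S _; rewrite mdeg1.
have [|f mf] := @level_mnm_surj d m; first by rewrite sm; case: fC.
rewrite -sm mf coloring_complex_level // in fC.
have uf : uniq (levels f).
  by apply: uniq_levels; rewrite -mf sm dm.
rewrite -dm (leq_trans (level_inj_card_image uf)) //.
exact: nonproper_card_image fC.
Qed.

Lemma coloring_complex_facet x y : adj x y ->
  exists2 C, coloring_complex adj C & #|C| = d.
Proof.
move=> axy; have xy : x != y by apply: contraTneq axy => ->; rewrite adj_irr.
pose s := enum [set~ y].
have szs : size s = d.-1 by rewrite -cardE cardsC1 card_ord.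
(* Exactly the colors 1, ..., d - 1 are used: leaving out 0 and d puts the empty set and the full
   set among the level sets, d in all. *)
pose f : {ffun 'I_d -> 'I_d.+1} := [ffun z => inord (index (merge x y z) s).+1].
have fE z : f z = (index (merge x y z) s).+1 :> nat.
  by rewrite ffunE inordK // ltnS (leq_ltn_trans (index_size _ _)) // szs ltn_predL.
exists (mnm_supp (level_mnm f)).
  apply/coloring_complex_level => //.
  apply/forallPn; exists x; apply/forallPn; exists y; rewrite axy negbK /=.
  by rewrite -val_eqE /= !fE !ffunE eqxx if_same.
rewrite mnm_supp_level_mnm cardsE; suff /card_uniqP -> : uniq (levels f).
  by rewrite size_map size_iota.
rewrite map_inj_in_uniq ?iota_uniq // => i j.
rewrite !mem_iota !add0n /= => id jd; move: i j id jd.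
suff H i j : (i < j < d)%N -> level f i != level f j.
  move=> i j id jd /eqP e; case: (ltngtP i j) => // ij.
    by have := H i j; rewrite ij jd e => /(_ isT).
  by have := H j i; rewrite ij id eq_sym e => /(_ isT).
case/andP=> ij jd; have j0 : (0 < j)%N by exact: leq_ltn_trans ij.
have lj : (j.-1 < size s)%N by rewrite szs -ltnS !prednK.
(* This vertex has color j, so it lies in L_j but not in L_i. *)
apply/negP => /eqP/setP/(_ (nth x s j.-1)); rewrite !inE !fE.
have := mem_nth x lj; rewrite mem_enum !inE => nyj.
rewrite !ffunE (negPf nyj) index_uniq ?enum_uniq // prednK // leqnn.
by rewrite leqNgt ij.
Qed.

Lemma dim1_coloring_complex x y : adj x y -> dim1 (coloring_complex adj) = d.
Proof.
move=> axy; apply/eqP; rewrite eqn_leq; apply/andP; split.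
  by apply/bigmax_leqP => C /asboolP; exact: coloring_complex_card.
have [C fC cC] := coloring_complex_facet axy; rewrite -[X in (X <= _)%N]cC.
by apply: (leq_bigmax_cond C); apply/asboolP.
Qed.

End Dimension.

(** * Generating functions of the tail and of the Hilbert functions *)

Theorem theorem3p3 (k : fieldType) (d : nat) (adj : rel 'I_d)
    (d_gt0 : (0 < d)%N) (adj_sym : symmetric adj) (adj_irr : irreflexive adj) :
  exists h T : {poly int},
    [/\ (* h is h(R/K_G, t), a polynomial *)
        has_gf (fun n => (hilbert (coloring_ideal adj k) n)%:Z) h d,
        (* the displayed identity, multiplied by t *)
        has_gf (chromatic_tail adj) ('X * h) d,
        (* T is T_G as a polynomial *)
        forall n : nat, T.[n%:R] = chromatic_tail adj n,
        W_transform T ('X * h)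
      & h_vector k (coloring_complex adj) h].
Proof.
pose a n := (nonproper adj n)%:Z.
have a0 : a 0%N = 0 by rewrite /a nonproper0.
(* The index i + 1 divides by t, and the cutoff loses nothing since [conv d a] vanishes from d
   on. *)
pose h : {poly int} := \poly_(i < d) conv d a i.+1.
have hE n : h`_n = conv d a n.+1.
  by rewrite coef_poly; case: ltnP => // dn; rewrite conv_nonproper // leqW.
have gf_h : has_gf (fun n => a n.+1) h d.
  move=> n; rewrite hE -[RHS](conv_shift d (fun i => a i.+1) n).
  by apply: eq_conv => -[].
have gf_Xh : has_gf a ('X * h) d.
  by move=> [|n]; rewrite coefXM /= ?hE // big_ord1 subnn a0 mulr0.
have eq_gf b c p D : b =1 c -> has_gf b p D -> has_gf c p D.
  by move=> bc gf n; rewrite gf; apply: eq_bigr => i _; rewrite bc.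
(* Without edges the tail vanishes, and has neither degree d - 1 nor a complex of
   dimension d - 1, but then the exponent of 1 - t is irrelevant. *)
have exponent D : (forall x y, adj x y -> D = d) ->
    has_gf (fun n => a n.+1) h D /\ has_gf a ('X * h) D.
  move=> Dd; have [[x [y /Dd ->]] //|noedge] := pselect (exists x y, adj x y).
  have az : a =1 fun=> 0.
    move=> n; rewrite /a nonproper_noedge // => x y.
    by apply/negbTE/negP => axy; apply: noedge; exists x, y.
  have h0 : h = 0 by apply/polyP => n; rewrite hE coef0 (eq_conv _ az) conv0.
  by rewrite h0 mulr0; split=> n; rewrite coef0 big1 // => i _; rewrite az mulr0.
exists h, (tail_poly adj); split.
- by apply: eq_gf gf_h => n; rewrite hilbert_coloring_ideal.
- by apply: eq_gf gf_Xh => n; rewrite chromatic_tailE.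
- by move=> n; rewrite tail_polyE.
- have [|_ gf] := exponent (size (tail_poly adj)).
    by move=> x y; exact: size_tail_poly.
  by apply: eq_gf gf => n; rewrite tail_polyE chromatic_tailE.
- have [|gf _] := exponent (dim1 (coloring_complex adj)).
    by move=> x y; exact: dim1_coloring_complex.
  by apply: eq_gf gf => n; rewrite hilbert_coloring_complex.
Qed.
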